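(* For each $i\in\mathbb N$ let $G_i$ be a countable group of homeomorphisms of a metrizable compact space $X_i$, and assume that every $G_i$ acts chaotically on $X_i$. Let $G=\prod_{i\in\mathbb N}G_i$ act canonically on the Tychonoff product $X=\prod_{i\in\mathbb N}X_i$. Then: (1) the canonical action of $G$ on $X$ is chaotic; (2) there exists a dense subset $F\subset X$ which is a union of compact orbits of $G$ each having the cardinality of the continuum, and every such orbit is a perfect subset of $X$; (3) there exists a dense orbit of $G$ in $X$ having the cardinality of the continuum; (4) all groups $G_i$, $i\in\mathbb N$, and $G$ are residually finite; (5) all groups $G_i$, $i\in\mathbb N$, and $G$ are sensitive to initial conditions (with respect to every metric metrizing $X_i$, respectively $X$); (6) if each group $G_i$ has a fixed point, then the union of the finite orbits of $G$ is dense in $X$, and $G$ has a fixed point.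
   Context: ''Countable'' means finite or countably infinite. No topology on the groups is assumed. The canonical action of $G=\prod_i G_i$ (with componentwise multiplication) on $X=\prod_i X_i$ is $\{g_i\}.\{x_i\}=\{g_i.x_i\}$; the Tychonoff product carries the product topology. The orbit of $x$ is $G.x=\{g.x : g\in G\}$; a closed (non-closed) orbit is an orbit that is (is not) a closed subset of the space. A group of homeomorphisms $G$ of a topological space $X$ is chaotic (acts chaotically) on $X$ if (1) there exists a dense non-closed orbit of $G$ in $X$, and (2) the union of the closed orbits of $G$ is dense in $X$. A subset is perfect if it is closed and has no isolated points. A group is residually finite if for every non-neutral element $g$ there is a normal subgroup of finite index not containing $g$. A fixed point of a group is a point fixed by all its elements. A homeomorphism group $G$ of a metric space $(X,d)$ is sensitive to initial conditions if there exists $\delta>0$ such that for every nonempty open subset $U\subset X$ there exists $g\in G$ with $\operatorname{diam}(g.U)\ge\delta$. *)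

(* Defs.v *)
From HB Require Import structures.
From mathcomp Require Import all_boot all_order all_algebra.
From mathcomp Require Import all_classical all_reals all_analysis.

Set Implicit Arguments.
Unset Strict Implicit.
Unset Printing Implicit Defensive.

Import Order.TTheory GRing.Theory Num.Theory.
Local Open Scope classical_set_scope.
Local Open Scope ring_scope.

(* The library only provides the direct product of two groups and the power of
   a group by a finite type; this is the unrestricted product of a family. *)
Definition prod_group {I : Type} (G : I -> Type) : Type := forall i, G i.

Section ProdGroup.
Context {I : Type} (G : I -> groupType).

Definition prod_one : prod_group G := fun=> 1%g.
Definition prod_inv (g : prod_group G) : prod_group G := fun i => (g i)^-1%g.
Definition prod_mul (g h : prod_group G) : prod_group G :=
  fun i => (g i * h i)%g.

Fact prod_mulA : associative prod_mul.
Proof. by move=> f g h; apply: functional_extensionality_dep => i; exact: mulgA. Qed.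

Fact prod_mul1g : left_id prod_one prod_mul.
Proof. by move=> g; apply: functional_extensionality_dep => i; exact: mul1g. Qed.

Fact prod_mulg1 : right_id prod_one prod_mul.
Proof. by move=> g; apply: functional_extensionality_dep => i; exact: mulg1. Qed.

Fact prod_mulVg : left_inverse prod_one prod_inv prod_mul.
Proof. by move=> g; apply: functional_extensionality_dep => i; exact: mulVg. Qed.

Fact prod_mulgV : right_inverse prod_one prod_inv prod_mul.
Proof. by move=> g; apply: functional_extensionality_dep => i; exact: mulgV. Qed.

HB.instance Definition _ := Choice.copy (prod_group G) (forall i, G i).
HB.instance Definition _ := isGroup.Build (prod_group G)
  prod_mulA prod_mul1g prod_mulg1 prod_mulVg prod_mulgV.

End ProdGroup.

(* [act g] is a homeomorphism, its inverse being [act g^-1]. *)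
Record homeo_action (G : groupType) (X : topologicalType) := HomeoAction {
  act :> G -> X -> X ;
  act_id : forall x, act 1%g x = x ;
  act_mul : forall g h x, act (g * h)%g x = act g (act h x) ;
  act_continuous : forall g, continuous (act g) }.

(* A group of homeomorphisms of [X], i.e. a subgroup of Homeo(X), is a group
   acting on [X] by homeomorphisms in such a way that distinct elements are
   distinct maps. *)
Definition homeo_group (G : groupType) (X : topologicalType)
  (a : homeo_action G X) : Prop := injective a.

Section ProdAction.
Context {I : eqType} (G : I -> groupType) (X : I -> topologicalType).
Variable a : forall i, homeo_action (G i) (X i).

Definition prod_act_fun (g : prod_group G) (x : prod_topology X) :
  prod_topology X := fun i => a i (g i) (x i).

Fact prod_act_id x : prod_act_fun 1%g x = x.
Proof. by apply: functional_extensionality_dep => i; exact: act_id. Qed.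

Fact prod_act_mul g h x :
  prod_act_fun (g * h)%g x = prod_act_fun g (prod_act_fun h x).
Proof. by apply: functional_extensionality_dep => i; exact: act_mul. Qed.

Fact prod_act_continuous g : continuous (prod_act_fun g).
Proof.
move=> x; apply/cvg_sup.
  exact/fmap_filter/(nbhs_filter (x : prod_topology X)).
move=> i; move: x.
apply/(@continuousP _ (initial_topology (fun y => y i))) => A [B oB <-].
have -> : prod_act_fun g @^-1` ((fun y => y i) @^-1` B) =
  @proj I X i @^-1` (a i (g i) @^-1` B) by [].
have oaB : open (a i (g i) @^-1` B).
  by apply: open_comp => // y _; exact: act_continuous.
by apply: open_comp => // y _; exact: proj_continuous.
Qed.

Definition prod_act : homeo_action (prod_group G) (prod_topology X) :=
  HomeoAction prod_act_id prod_act_mul prod_act_continuous.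

Lemma prod_homeo_group : (forall i, [set: X i] !=set0) ->
  (forall i, homeo_group (a i)) -> homeo_group prod_act.
Proof.
move=> X0 ia g h gh; apply: functional_extensionality_dep => i.
have x0 j : {x : X j | True} by apply: cid; have [x _] := X0 j; exists x.
apply: ia; apply: funext => x.
pose z : prod_topology X := dfwith (fun j => projT1 (x0 j)) i x.
have := congr1 (fun f => f z i) gh.
by rewrite /= /prod_act_fun /z dfwithin.
Qed.

End ProdAction.

Section Dynamics.
Context (G : groupType) (X : topologicalType) (a : homeo_action G X).

Definition act_orbit (x : X) : set X := range (a^~ x).

Definition chaotic : Prop :=
  (exists2 x, dense (act_orbit x) & ~ closed (act_orbit x)) /\
  dense (\bigcup_(x in [set x | closed (act_orbit x)]) act_orbit x).

Definition fixed_point (x : X) : Prop := forall g, a g x = x.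

End Dynamics.

Definition normal_subgroup (G : groupType) (N : {pred G}) : Prop :=
  group_closed N /\ forall g x, x \in N -> conjg x g \in N.

Definition finite_index (G : groupType) (N : {pred G}) : Prop :=
  finite_set (range (fun g : G => [set (g * x)%g | x in [set` N]])).

Definition residually_finite (G : groupType) : Prop :=
  forall g : G, g <> 1%g ->
    exists N : {pred G}, [/\ normal_subgroup N, finite_index N & g \notin N].

Section Metrics.
Context (R : realType).

Definition is_metric (T : Type) (d : T -> T -> R) : Prop :=
  [/\ forall x y, 0 <= d x y,
      forall x y, d x y = 0 <-> x = y,
      forall x y, d x y = d y x &
      forall x y z, d x z <= d x y + d y z].

Definition metrizes (T : topologicalType) (d : T -> T -> R) : Prop :=
  is_metric d /\
  forall (x : T) (A : set T),
    nbhs x A <-> exists2 e : R, 0 < e & [set y | d x y < e] `<=` A.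

Definition metrizable (T : topologicalType) : Prop :=
  exists d : T -> T -> R, metrizes d.

Definition diam (T : Type) (d : T -> T -> R) (A : set T) : \bar R :=
  ereal_sup [set (d p.1 p.2)%:E | p in A `*` A].

Definition sensitive (G : groupType) (X : topologicalType)
    (a : homeo_action G X) (d : X -> X -> R) : Prop :=
  exists2 delta : R, 0 < delta &
    forall U : set X, open U -> U !=set0 ->
      exists g : G, (delta%:E <= diam d (a g @` U))%E.

End Metrics.

(* Main.v *)
Require Import Defs.
From mathcomp Require Import all_boot all_order all_algebra.
From mathcomp Require Import all_classical all_reals all_analysis.
From mathcomp Require Import finmap lra.

(* Everything reduces to the factors. A closed orbit of a countable group on a
   compact metrizable space is finite, by Baire: by homogeneity it either is
   discrete or has no isolated point. Hence points with finite orbit are dense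
   in each X_i, which gives residual finiteness (pointwise stabilizers of finite
   orbits) and sensitivity. An orbit of the product is the product of the orbits
   of the coordinates; it therefore has the cardinality of the continuum as soon
   as no coordinate is a fixed point, and it is perfect if moreover it is
   compact, again by homogeneity. *)

Set Implicit Arguments.
Unset Strict Implicit.
Unset Printing Implicit Defensive.

Import Order.TTheory GRing.Theory Num.Theory.
Local Open Scope classical_set_scope.
Local Open Scope card_scope.

(** * Sets with the cardinality of the continuum *)

Section Continuum.
Local Open Scope ring_scope.

Lemma injective_card_le (T U : Type) (A : set T) (B : set U) (f : T -> U) :
  {in A &, injective f} -> (forall x, A x -> B (f x)) -> A #<= B.
Proof.
move=> finj AB; apply: (@card_le_trans _ _ _ (f @` A)).
  by have := inj_card_eq finj; rewrite card_eq_le => /andP[].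
by apply: subset_card_le => _ [x Ax <-]; exact: AB.
Qed.

Lemma countType_pred_card_le (T : countType) :
  [set: T -> bool] #<= [set: nat -> bool].
Proof.
pose f (p : T -> bool) n := if choice.unpickle n is Some t then p t else false.
apply: (@injective_card_le _ _ _ _ f) => // p q _ _ pq.
apply: funext => t; have := congr1 (fun h => h (choice.pickle t)) pq.
by rewrite /f choice.pickleK.
Qed.

Context (R : realType).
Implicit Types b c : nat -> bool.

(** Base 3 with digits 0 and 1 only: everything after place [n] adds up to at most half of [3 ^- n],
    so distinct digit sequences have distinct sums. *)
Definition ternary_sum b n : R := \sum_(k < n) (b k)%:R * (3%:R ^- k).

Lemma ternary_sumS b n :
  ternary_sum b n.+1 = ternary_sum b n + (b n)%:R * (3%:R ^- n).
Proof. by rewrite /ternary_sum big_ord_recr. Qed.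

(** The upper bound is the geometric sum obtained when all digits from [n] to [n + m - 1] are 1. *)
Lemma ternary_sum_bounds b n m :
  ternary_sum b n <= ternary_sum b (n + m)
  <= ternary_sum b n + 3%:R / 2%:R * (3%:R ^- n - 3%:R ^- (n + m)).
Proof.
elim: m => [|m /andP[IH1 IH2]]; first by rewrite addn0; apply/andP; split; lra.
rewrite addnS ternary_sumS exprSr invfM.
have : 0 < (3%:R : R) ^- (n + m) by rewrite invr_gt0 exprn_gt0.
move: (3%:R ^- (n + m)) IH1 IH2 => t IH1 IH2 t0.
have b01 : 0 <= ((b (n + m)%N)%:R : R) <= 1 by case: (b _); rewrite /= ?lexx ?ler01.
by apply/andP; split; nra.
Qed.

Definition ternary b : R := sup (range (ternary_sum b)).

Lemma ternary_bounds b n :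
  ternary_sum b n <= ternary b <= ternary_sum b n + 3%:R / 2%:R * 3%:R ^- n.
Proof.
have ub k : ubound (range (ternary_sum b))
    (ternary_sum b k + 3%:R / 2%:R * 3%:R ^- k).
  move=> _ [m _ <-].
  have p j : 0 < (3%:R : R) ^- j by rewrite invr_gt0 exprn_gt0.
  have [/subnKC <-|/ltnW/subnKC <-] := leqP k m.
    have /andP[_] := ternary_sum_bounds b k (m - k).
    by have := p (k + (m - k))%N; have := p k; lra.
  have /andP[+ _] := ternary_sum_bounds b m (k - m).
  by have := p (m + (k - m))%N; lra.
apply/andP; split.
  by apply: ub_le_sup; [exists (ternary_sum b 0 + 3%:R / 2%:R * 3%:R ^- 0)|exists n].
by apply: ge_sup => //; exists (ternary_sum b 0), 0%N.
Qed.

(** At the first difference [c] gains [3 ^- n], while the remaining digits of [b] contribute at most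
    half of that. *)
Lemma ternary_lt b c n :
  (forall k, (k < n)%N -> b k = c k) -> b n = false -> c n ->
  ternary b < ternary c.
Proof.
move=> bc bn cn.
have E : ternary_sum b n = ternary_sum c n.
  by apply: eq_bigr => i _; rewrite bc.
have /andP[_] := ternary_bounds b n.+1; have /andP[+ _] := ternary_bounds c n.+1.
rewrite !ternary_sumS bn cn E exprSr invfM mul0r addr0 mul1r.
have : 0 < (3%:R : R) ^- n by rewrite invr_gt0 exprn_gt0.
by move: (3%:R ^- n) => t; lra.
Qed.

Lemma ternary_inj : injective ternary.
Proof.
move=> b c bc; apply: contrapT => /eqP bNc.
have ex : exists n, b n != c n.
  apply/not_existsP => H; move/eqP : bNc; apply; apply: funext => n.
  by have /negP/negPn/eqP := H n.
case: (ex_minnP ex) => n bn min.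
have lt k : (k < n)%N -> b k = c k.
  by move=> kn; apply/eqP; apply: contraTT kn; rewrite -leqNgt; exact: min.
case: (boolP (b n)) (boolP (c n)) bn => [Bn|/negbTE Bn] [Cn|/negbTE Cn].
- by [].
- have ltE k : (k < n)%N -> c k = b k by move/lt.
  by have := ternary_lt ltE Cn Bn; rewrite bc ltxx.
- by have := ternary_lt lt Bn Cn; rewrite bc ltxx.
- by [].
Qed.

(** Two injections: [ternary], and the lower Dedekind cut of a real, a predicate on the countable
    type [rat]. *)
Lemma card_real : [set: nat -> bool] #= [set: R].
Proof.
rewrite card_eq_le; apply/andP; split.
  by apply: (@injective_card_le _ _ _ _ ternary) => // b c _ _ /ternary_inj.
apply: card_le_trans (countType_pred_card_le rat).
apply: (@injective_card_le _ _ _ _ (fun (x : R) q => ratr q < x)) => // x y _ _ xy.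
apply/eqP; rewrite eq_le; apply/andP; split; rewrite leNgt; apply/negP.
  move=> /rat_in_itvoo[q]; rewrite in_itv/= => /andP[yq qx].
  by have := congr1 (fun h => h q) xy; rewrite qx ltNge (ltW yq).
move=> /rat_in_itvoo[q]; rewrite in_itv/= => /andP[xq qy].
by have := congr1 (fun h => h q) xy; rewrite qy ltNge (ltW xq).
Qed.

(** Numbering each [A i] turns a point into its graph, a subset of [nat * nat]. Conversely, two
    chosen points in each [A i] let a sequence of bits select a point of the product. *)
Lemma card_prod_continuum (X : nat -> Type) (A : forall i, set (X i)) :
  (forall i, countable (A i)) ->
  (forall i, exists x y, [/\ A i x, A i y & x <> y]) ->
  [set x : forall i, X i | forall i, A i (x i)] #= [set: R].
Proof.
move=> cA A2; apply: card_eq_trans card_real.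
rewrite card_eq_le; apply/andP; split.
  apply: card_le_trans (countType_pred_card_le (nat * nat)%type).
  have f i : {f : X i -> nat | {in A i &, injective f}}.
    by apply: cid; have /countable_injP[f] := cA i; exists f.
  apply: (@injective_card_le _ _ _ _ (fun x p => sval (f p.1) (x p.1) == p.2)) => //.
  move=> x y /set_mem Ax /set_mem Ay xy.
  apply: functional_extensionality_dep => i.
  apply: (svalP (f i)); [exact/mem_set/Ax|exact/mem_set/Ay|].
  have := congr1 (fun h => h (i, sval (f i) (y i))) xy.
  by rewrite /= eqxx => /eqP.
have p i : {p : X i * X i | [/\ A i p.1, A i p.2 & p.1 <> p.2]}.
  by apply: cid; have [x [y H]] := A2 i; exists (x, y).
pose F (b : nat -> bool) i := if b i then (sval (p i)).1 else (sval (p i)).2.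
apply: (@injective_card_le _ _ _ _ F) => [b c _ _ bc|b _ i /=].
  apply: funext => i; have [_ _] := svalP (p i); have := congr1 (fun h => h i) bc.
  by rewrite /F; case: (b i) (c i) => -[] // ->.
by have [] := svalP (p i); rewrite /F; case: ifP.
Qed.

End Continuum.

(** * Compact discrete sets and perfect sets *)

Lemma compact_isolated_finite (T : topologicalType) (K : set T) :
  compact K -> K `<=` isolated K -> finite_set K.
Proof.
move=> /compact_near_coveringP/near_covering_withinP Kco Kiso.
(* Near [F], a set is finite and contains any prescribed finite set; the near-covering form of
   compactness then gathers the finitely many isolated points. *)
pose F := filter_from [set S : set T | finite_set S]
  (fun S => [set S' | finite_set S' /\ S `<=` S']).
have FF : Filter F.
  apply: filter_from_filter; first by exists set0; exact: finite_set0.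
  move=> S S' fS fS'; exists (S `|` S'); first by rewrite /= finite_setU.
  by move=> U [fU SU]; split; split=> // x Sx; apply: SU; [left|right].
have /Kco : forall x, K x ->
    \forall x' \near x & S \near F, K x' -> S x' /\ finite_set S.
  move=> x /Kiso[_ [V xV VK]].
  exists (V, [set S | finite_set S /\ [set x] `<=` S]).
    by split => //; exists [set x] => //; exact: finite_set1.
  move=> [y S]/= [Vy [fS xS]] Ky; split => //.
  have : (V `&` K) y by [].
  by rewrite VK => ->; exact: xS.
move=> [S fS KS]; have {KS} : K `<=` S.
  by move=> x Kx; have [] := KS S (conj fS (@subset_refl _ S)) x Kx.
by move=> KS; exact: sub_finite_set fS.
Qed.

(* Baire's argument: nested closed sets shrink away from every point of an
   enumeration of [K]. *)
Lemma perfect_uncountable (T : topologicalType) (K : set T) :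
  hausdorff_space T -> compact [set: T] -> perfect_set K -> K !=set0 ->
  ~ countable K.
Proof.
move=> hT cT [clK limK] [p0 Kp0] /countable_injP[e einj].
have cK : compact K by exact: subclosed_compact cT _.
have reg (x : T) : {for x, regular_space T}.
  by apply: compact_regular hT cT _; exact: filterT.
(* The invariant of the nested sequence: the interior still meets [K]. *)
pose good := {V : set T | K `&` V° !=set0}.
have step (V : good) (n : nat) : exists W : good, sval W `<=` sval V /\
    forall y, K y -> e y = n -> ~ closure (sval W) y.
  case: V => V /= [p [Kp Vp]].
  (* If [p] itself has number [n], it is a limit point of [K], and a nearby point of [K] has another
     number. *)
  have [q [Kq Vq qn]] : exists q, [/\ K q, V° q & e q <> n].
    have [<-|pn] := eqVneq (e p) n; last by exists p; split=> //; exact/eqP.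
    have : limit_point K p by rewrite limK.
    move=> /(_ V°); have /[swap]/[apply] : nbhs p V°.
      exact: nbhs_interior.
    move=> [q [qp Kq Vq]]; exists q; split=> // eqp.
    by move/eqP: qp; apply; apply: einj => //; exact/mem_set.
  have clA (y : T) : closed [set y].
    exact/accessible_closed_set1/hausdorff_accessible.
  have qU : nbhs q (V `&` ~` [set y | K y /\ e y = n]).
    apply: filterI => //.
    have [[y [Ky ey]]|H] := pselect (exists y, K y /\ e y = n).
      have -> : [set y | K y /\ e y = n] = [set y].
        apply/seteqP; split=> [z [Kz ez]|z ->//].
        by apply: einj; [exact/mem_set|exact/mem_set|rewrite ez].
      apply: open_nbhs_nbhs; split; first by rewrite openC; exact: clA.
      by move=> qy; apply: qn; rewrite qy.
    by apply: filterS (@filterT _ (nbhs q) _) => y _ Hy; apply: H; exists y.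
  (* Regularity gives a neighbourhood whose closure stays in [V] and avoids the point numbered
     [n]. *)
  have [W qW WU] := reg q _ qU.
  have gW : K `&` W° !=set0 by exists q; split.
  exists (exist _ W gW); split=> /=.
    by move=> y Wy; have [] := WU _ (subset_closure Wy).
  by move=> y Ky ey Wy; have [_] := WU _ Wy; apply.
have /choice[next nextP] : forall Vn : good * nat, exists W : good,
    sval W `<=` sval Vn.1 /\
    forall y, K y -> e y = Vn.2 -> ~ closure (sval W) y.
  by move=> [V n]; exact: step.
have good0 : K `&` setT° !=set0 by exists p0; rewrite interiorT.
pose V := fix V n : good :=
  if n is m.+1 then next (V m, m) else exist _ setT good0.
have Vdec n m : (n <= m)%N -> sval (V m) `<=` sval (V n).
  move=> /subnK <-; elim: (m - n)%N => // k IH x /= Vx.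
  by apply: IH; have [+ _] := nextP (V (k + n)%N, (k + n)%N); apply.
pose F := filter_from [set: nat] (fun n => K `&` sval (V n)).
have FF : ProperFilter F.
  apply: filter_from_proper.
    apply: filter_from_filter; first by exists 0%N.
    move=> i j _ _; exists (maxn i j) => // x [Kx Vx].
    by split; split => //; apply: Vdec Vx; rewrite (leq_maxl, leq_maxr).
  by move=> n _; have [x [Kx /interior_subset Vx]] := svalP (V n); exists x.
(* A cluster point [x] lies in the closure of every [V n], yet [V (e x).+1] was chosen with closure
   avoiding [x]. *)
have [|x [Kx xF]] := cK F FF; first by exists 0%N => // x [].
have [_ /(_ x Kx erefl)] := nextP (V (e x), e x); apply.
move=> U xU; apply: (xF _ U _ xU).
by exists (e x).+1 => // y [].
Qed.

(** * Orbits of a group of homeomorphisms *)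

Section Orbits.
Context (G : groupType) (X : topologicalType) (a : homeo_action G X).

Lemma act_orbit_refl x : act_orbit a x x.
Proof. by exists 1%g => //; exact: act_id. Qed.

Lemma actK g : cancel (a g) (a g^-1%g).
Proof. by move=> x; rewrite -act_mul mulVg act_id. Qed.

Lemma actVK g : cancel (a g^-1%g) (a g).
Proof. by move=> x; rewrite -act_mul mulgV act_id. Qed.

Lemma act_orbit_act x g y : act_orbit a x y -> act_orbit a x (a g y).
Proof. by move=> [h _ <-]; exists (g * h)%g => //; exact: act_mul. Qed.

Lemma act_orbit_eq x y : act_orbit a x y -> act_orbit a x = act_orbit a y.
Proof.
move=> [g _ <-]; apply/seteqP; split=> [_ [h _ <-]|_ [h _ <-]].
  by exists (h * g^-1)%g => //; rewrite act_mul actK.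
by exists (h * g)%g => //; rewrite act_mul.
Qed.

(** Homogeneity: [a g] is a homeomorphism preserving the orbit, so one isolated point makes all
    points of the orbit isolated. *)
Lemma act_orbit_isolated x g y :
  isolated (act_orbit a x) y -> isolated (act_orbit a x) (a g y).
Proof.
move=> [/set_mem xy [V yV VK]]; split; first exact/mem_set/act_orbit_act.
exists (a g^-1%g @^-1` V).
  by apply: act_continuous; rewrite actK.
apply/seteqP; split=> [z [/= Vz xz]|_ ->]; last first.
  by split; [rewrite /= actK; exact: nbhs_singleton|exact: act_orbit_act].
have : (V `&` act_orbit a x) (a g^-1%g z).
  by split => //; exact: act_orbit_act.
by rewrite VK => /= <-; rewrite actVK.
Qed.

Lemma open_moved g : hausdorff_space X -> open [set x | a g x <> x].
Proof.
rewrite open_hausdorff => hX; rewrite openE => x gx.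
have [[A B]/= [/set_mem Ax /set_mem Bx] [oA oB AB]] := hX _ _ (introN eqP gx).
have nB : nbhs x B by exact: open_nbhs_nbhs.
have nA : nbhs x (a g @^-1` A).
  by apply: act_continuous; exact: open_nbhs_nbhs.
apply: filterS (filterI nB nA) => y [By Ay] gy; rewrite /= gy in Ay.
by have : (A `&` B) y by []; rewrite (eqP AB).
Qed.

(** By homogeneity either no point of the orbit is isolated, or all are and compactness leaves
    finitely many. *)
Lemma compact_orbit_finite_or_perfect x : hausdorff_space X ->
  compact (act_orbit a x) ->
  finite_set (act_orbit a x) \/ perfect_set (act_orbit a x).
Proof.
move=> hX cx.
have [iso0|/set0P[y iso_y]] := eqVneq (isolated (act_orbit a x)) set0.
  by right; apply/perfectP; split=> //; exact: compact_closed.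
left; apply: compact_isolated_finite => // z xz.
have xy : act_orbit a x y by exact: isolatedS iso_y.
have [g _ <-] : act_orbit a y z by rewrite -(act_orbit_eq xy).
exact: act_orbit_isolated.
Qed.

(** A perfect orbit would be uncountable, but an orbit is an image of the countable group. *)
Lemma closed_orbit_finite x : countable [set: G] -> hausdorff_space X ->
  compact [set: X] -> closed (act_orbit a x) -> finite_set (act_orbit a x).
Proof.
move=> cG hX cX clx.
have cx : compact (act_orbit a x) by exact: subclosed_compact clx cX _.
have [//|/perfect_uncountable] := compact_orbit_finite_or_perfect hX cx.
move=> /(_ hX cX)[]; first by exists x; exact: act_orbit_refl.
exact: sub_countable (card_image_le _ _) cG.
Qed.

End Orbits.

(** * Finite orbits and residual finiteness *)

Lemma finite_near (T : topologicalType) (I : choiceType) (D : set I)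
    (P : I -> set T) (x : T) :
  finite_set D -> (forall i, D i -> \forall y \near x, P i y) ->
  \forall y \near x, forall i, D i -> P i y.
Proof.
move=> /finite_fsetP[S ->] H.
have : nbhs x (\bigcap_(i in [set` S]) P i) by exact: filter_bigI.
by apply: filterS => y Py i Di; exact: Py.
Qed.

(** [F] factors through [f]. This will bound the number of cosets by the number of self-maps of a
    finite orbit. *)
Lemma finite_range_factor (T : choiceType) (U V : Type) (f : T -> U) (F : T -> V) :
  finite_set (range f) -> (forall x y, f x = f y -> F x = F y) ->
  finite_set (range F).
Proof.
move=> ff fF.
have [[x0 _]|T0] := pselect (exists x : T, True); last first.
  suff -> : range F = set0 by exact: finite_set0.
  by apply/seteqP; split=> // ? [x _ _]; apply: T0; exists x.
pose g v := F (xget x0 (f @^-1` [set v])).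
apply: (sub_finite_set _ (finite_image g ff)) => _ [x _ <-].
exists (f x); first by exists x.
by apply: fF; exact: (@xgetPex _ x0 (f @^-1` [set f x]) (ex_intro _ x erefl)).
Qed.

(** The points moved by [g] form a nonempty open set, so [g] moves a point of some finite orbit. The
    pointwise stabilizer of that orbit is normal and omits [g]; its cosets are determined by the
    induced self-maps of the orbit. *)
Lemma residually_finite_of_finite_orbits (G : groupType) (X : topologicalType)
    (a : homeo_action G X) :
  homeo_group a -> hausdorff_space X ->
  dense (\bigcup_(x in [set x | finite_set (act_orbit a x)]) act_orbit a x) ->
  residually_finite G.
Proof.
move=> inj_a hX dX g g1.
have [x gx] : exists x, a g x <> x.
  apply/existsNP => H; apply: g1; apply: inj_a; apply: funext => x.
  by rewrite H act_id.
have [y [gy [z /= fz zy]]] := dX _ (ex_intro _ x gx) (open_moved a g hX).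
pose N : {pred G} := [pred h | `[< forall w, act_orbit a z w -> a h w = w >]].
have inN h : (h \in N) <-> (forall w, act_orbit a z w -> a h w = w).
  by rewrite inE; split=> [/asboolP|?]; [|exact/asboolP].
have N1 : 1%g \in N by apply/inN => w _; exact: act_id.
have NV h : h \in N -> h^-1%g \in N.
  by move=> /inN hN; apply/inN => w zw; rewrite -{1}(hN w zw) actK.
have NM h k : h \in N -> k \in N -> (h * k)%g \in N.
  move=> /inN hN /inN kN; apply/inN => w zw; rewrite act_mul kN//.
  exact: hN.
exists N; split.
- split; first by split => // h k hN kN; exact/NM/NV.
  move=> h k /inN kN; apply/inN => w zw.
  rewrite /conjg !act_mul kN ?actK//; exact: act_orbit_act.
- have [S SE] := finite_fsetP.1 fz.
  (* The self-map of the orbit induced by [h]; the default of [insubd] is never reached, as the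
     orbit is invariant. *)
  pose f h : {ffun S -> S} := [ffun w => insubd w (a h (val w))].
  apply: (@finite_range_factor _ _ _ f); first exact: finite_finset.
  move=> h k hk.
  have hkE w : act_orbit a z w -> a h w = a k w.
    move=> zw; have wS : w \in S by move: zw; rewrite SE.
    have Sin l : a l w \in S.
      by have := act_orbit_act l zw; rewrite SE.
    have := congr1 (fun u : {ffun S -> S} => val (u [` wS]%fset)) hk.
    by rewrite !ffunE !val_insubd /= !Sin.
  apply/seteqP; split=> _ [n /= nN <-].
    exists (k^-1 * (h * n))%g; last by rewrite mulVKg.
    apply/inN => w zw; rewrite !act_mul (inN n).1// hkE//.
    by rewrite actK.
  exists (h^-1 * (k * n))%g; last by rewrite mulVKg.
  apply/inN => w zw; rewrite !act_mul (inN n).1// -hkE//.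
  by rewrite actK.
- by apply/negP => /inN /(_ y zy); exact: gy.
Qed.

(** Pull a subgroup back along the projection to a coordinate where [g] is nontrivial; its cosets
    are preimages of cosets. *)
Lemma residually_finite_prod (I : Type) (G : I -> groupType) :
  (forall i, residually_finite (G i)) -> residually_finite (prod_group G).
Proof.
move=> rG g g1.
have [i gi] : exists i, g i <> 1%g.
  apply/existsNP => H; apply: g1; apply: functional_extensionality_dep => i.
  exact: H.
have [N [[[N1 NV] NJ] fN gN]] := rG i (g i) gi.
pose N' : {pred prod_group G} := fun h => h i \in N.
exists N'; split=> //.
- split; first by split=> // h k /= hN kN; exact: (NV (h i) (k i)).
  by move=> h k /= kN; exact: (NJ (h i) (k i)).
- apply: (sub_finite_set _ (finite_image (fun S : set (G i) =>
    [set h : prod_group G | S (h i)]) fN)) => _ [h _ <-].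
  exists [set (h i * x)%g | x in [set` N]].
    by exists (h i).
  apply/seteqP; split=> [k [n /= nN nE]|_ [n nN <-]].
    exists (h^-1 * k)%g; last by rewrite mulVKg.
    suff : ((h i)^-1 * k i)%g \in N by [].
    by rewrite -nE mulKg.
  by exists (n i).
Qed.

(** * Topology and orbits of the product *)

Section ProductSpace.
Context (X : nat -> topologicalType).
Implicit Types f x c : prod_topology X.

(** The product topology is a supremum of initial topologies, so it suffices that the filter [F] of
    boxes at [f] converges to [f] in each of them. *)
Lemma nbhs_prod_box f (A : set (prod_topology X)) : nbhs f A ->
  exists n (U : forall i, set (X i)), (forall i, nbhs (f i) (U i)) /\
    forall x, (forall i, (i < n)%N -> U i (x i)) -> A x.
Proof.
pose F : set_system (prod_topology X) :=
  filter_from [set p : nat * (forall i, set (X i)) | forall i, nbhs (f i) (p.2 i)]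
    (fun p => [set x | forall i, (i < p.1)%N -> p.2 i (x i)]).
have FF : Filter F.
  apply: filter_from_filter; first by exists (0%N, fun=> setT) => i; exact: filterT.
  move=> [n U] [m V] /= Uf Vf; exists (maxn n m, fun i => U i `&` V i).
    by move=> i; exact: filterI.
  move=> x /= H; split=> i ilt; have := H i;
    by rewrite leq_max ilt ?orbT => /(_ isT)[].
have : F --> f.
  apply/cvg_sup => i U [_ [[B oB <-] Bfi WU]].
  apply: (filterS WU).
  (* The bound [i.+1] makes coordinate [i] constrained; [eq_rect] transports [B] to index [j] when
     [i] and [j] agree, and other coordinates are free. *)
  exists (i.+1, fun j => if eqP is ReflectT e then
    eq_rect i (fun j => set (X j)) B j e else setT) => [j|x /(_ i (ltnSn i))] /=.
    case: eqP => [e|_]; last exact: filterT.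
    by destruct e => /=; exact: open_nbhs_nbhs.
  by case: eqP => // e; rewrite (eq_irrelevance e erefl).
move=> /(_ A) /[apply] -[[n U] /= Uf UA].
by exists n, U; split.
Qed.

(** A box inside [O] constrains only [n] coordinates, and [n] does not depend on [c]. The tail [c]
    will consist of points of dense sets in one use and of fixed points in the other. *)
Lemma open_prod_meets (S : forall i, set (X i)) (O : set (prod_topology X)) :
  (forall i, dense (S i)) -> open O -> O !=set0 ->
  exists n, forall c, exists2 x, O x &
    forall i, if (i < n)%N then S i (x i) else x i = c i.
Proof.
move=> dS oO [f Of].
have [n [U [Uf UO]]] := nbhs_prod_box (open_nbhs_nbhs (conj oO Of)).
have s i : {y | U i y /\ S i y}.
  apply: cid; have := Uf i; rewrite nbhsE => -[V [oV Vf] VU].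
  by have [y [/VU Uy Sy]] := dS i V (ex_intro _ _ Vf) oV; exists y.
exists n => c; exists (fun i => if (i < n)%N then sval (s i) else c i).
  by apply: UO => i ilt; rewrite ilt; have [] := svalP (s i).
by move=> i; case: (i < n)%N => //; have [] := svalP (s i).
Qed.

Lemma dense_prod (S : forall i, set (X i)) :
  (forall i, dense (S i)) -> dense [set x : prod_topology X | forall i, S i (x i)].
Proof.
move=> dS O O0 oO; have [f _] := O0.
have [n nP] := open_prod_meets dS oO O0.
have c i : {y | S i y}.
  apply: cid; have [y [_ Sy]] := dS i setT (ex_intro _ (f i) I) openT.
  by exists y.
have [x Ox xP] := nP (fun i => sval (c i)).
exists x; split=> // i; have := xP i; case: ifP => // _ ->.
exact: svalP (c i).
Qed.

Lemma closed_prod (A : forall i, set (X i)) : (forall i, closed (A i)) ->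
  closed [set x : prod_topology X | forall i, A i (x i)].
Proof.
move=> clA.
have -> : [set x : prod_topology X | forall i, A i (x i)] =
    \bigcap_i (@proj nat X i @^-1` A i).
  by apply/seteqP; split=> [x xA i _|x xA i]; [exact: xA|exact: xA].
by apply: closed_bigI => i _; apply: preimage_closed => // x _; exact: proj_continuous.
Qed.

Context (G : nat -> groupType) (a : forall i, homeo_action (G i) (X i)).

(** The group is the unrestricted product, so its coordinates can be chosen independently. *)
Lemma prod_act_orbitE x : act_orbit (prod_act a) x =
  [set y : prod_topology X | forall i, act_orbit (a i) (x i) (y i)].
Proof.
apply/seteqP; split=> [_ [g _ <-] i|y xy]; first by exists (g i).
have g i : {h | a i h (x i) = y i}.
  by apply: cid; have [h _ <-] := xy i; exists h.
exists (fun i => sval (g i)) => //.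
by apply: functional_extensionality_dep => i; exact: svalP (g i).
Qed.

Lemma proj_act_orbit x i :
  @proj nat X i @` act_orbit (prod_act a) x = act_orbit (a i) (x i).
Proof.
apply/seteqP; split=> [_ [_ [g _ <-] <-]|_ [g _ <-]]; first by exists (g i).
exists (prod_act a (dfwith (1%g : prod_group G) i g) x); first by eexists.
by rewrite /= /proj /prod_act_fun dfwithin.
Qed.

End ProductSpace.

(** * Metrics and sensitivity to initial conditions *)

Section Sensitivity.
Local Open Scope ring_scope.
Context (R : realType).

Lemma metrizes_nbhs (T : topologicalType) (d : T -> T -> R) x e :
  metrizes d -> 0 < e -> nbhs x [set y | d x y < e].
Proof. by move=> [_ dn] e0; apply/dn; exists e. Qed.

Lemma metrizable_hausdorff (T : topologicalType) :
  metrizable R T -> hausdorff_space T.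
Proof.
move=> [d dT]; have [[d0 dE dC dD] _] := dT => x y xy; apply/dE.
apply/eqP; rewrite eq_le d0 andbT leNgt; apply/negP => dxy.
have e0 : 0 < d x y / 2%:R by rewrite divr_gt0.
have [z /= [xz yz]] := xy _ _ (metrizes_nbhs x dT e0) (metrizes_nbhs y dT e0).
by have := dD x z y; rewrite (dC z y); lra.
Qed.

Lemma lt_diam (T : Type) (d : T -> T -> R) (A : set T) e :
  (e%:E < diam d A)%E -> exists x y, [/\ A x, A y & e < d x y].
Proof.
move=> /ereal_sup_gt[_ [[x y] [/= Ax Ay] <-]]; rewrite lte_fin => exy.
by exists x, y.
Qed.

Lemma le_diam (T : Type) (d : T -> T -> R) (A : set T) x y :
  A x -> A y -> ((d x y)%:E <= diam d A)%E.
Proof. by move=> Ax Ay; apply: ereal_sup_ubound; exists (x, y). Qed.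

(* If all translates of [U] were smaller than [e], moving a finite-orbit point
   [p] of [U] along with a point of [U] with dense orbit would bring [p] close
   both to [x0] and to the finite orbit of [q], which are far apart. *)
Lemma sensitive_of_finite_orbits (G : groupType) (X : topologicalType)
    (a : homeo_action G X) (d : X -> X -> R) x0 :
  metrizes d ->
  dense (act_orbit a x0) -> ~ closed (act_orbit a x0) ->
  dense (\bigcup_(x in [set x | finite_set (act_orbit a x)]) act_orbit a x) ->
  sensitive a d.
Proof.
move=> dX dx0 nclx0 dfin; have [[d0 dE dC dD] dn] := dX.
have hX : hausdorff_space X by apply: metrizable_hausdorff; exists d.
have clfin (A : set X) : finite_set A -> closed A.
  by move: A; apply/accessible_finite_set_closed/hausdorff_accessible.
have [q fq] : exists q, finite_set (act_orbit a q).
  have [_ [_ [q fq _]]] := dfin setT (ex_intro _ x0 I) openT.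
  by exists q.
have qx0 : ~ act_orbit a q x0.
  move=> qx0; apply: nclx0; apply: clfin.
  by rewrite -(act_orbit_eq qx0).
have [e e0 ex0] : exists2 e, 0 < e & forall y, act_orbit a q y -> e <= d x0 y.
  have : nbhs x0 (~` act_orbit a q).
    by apply: open_nbhs_nbhs; split=> //; rewrite openC; exact: clfin.
  move=> /dn[e e0 eq]; exists e => // y qy; rewrite leNgt; apply/negP => xy.
  exact: eq xy qy.
(* Three distances below [e / 4] will bound [d x0 (a k q)], which is at least [e]. *)
have e40 : 0 < e / 4%:R by rewrite divr_gt0.
exists (e / 4%:R) => // U oU U0; apply: contrapT => /forallNP noU.
have small g y z : U y -> U z -> d (a g y) (a g z) < e / 4%:R.
  move=> Uy Uz; have /negP := noU g; rewrite -ltNge => /(le_lt_trans _) H.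
  rewrite -lte_fin; apply: H; apply: le_diam; [by exists y|by exists z].
have [p [Up [p' /= fp' p'p]]] := dfin U U0 oU.
have fp : finite_set (act_orbit a p) by rewrite -(act_orbit_eq p'p).
have [z [Uz [g0 _ zE]]] := dx0 U U0 oU.
(* For each [r] in the finite orbit of [p], an element bringing [r] to [a g0^-1 p], which is close
   to [x0]. These are finitely many and fixed before [V], so one [V] serves them all; outside the
   orbit the value 1 is arbitrary. *)
have c r : {k | act_orbit a p r -> a k r = a g0^-1%g p}.
  apply: cid; have [[g _ <-]|nr] := pselect (act_orbit a p r); last by exists 1%g.
  by exists (g0^-1 * g^-1)%g; rewrite act_mul actK.
have : nbhs q [set y | forall r, act_orbit a p r ->
    d (a (sval (c r)) q) (a (sval (c r)) y) < e / 4%:R].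
  apply: finite_near => // r _.
  exact: (@act_continuous _ _ a (sval (c r)) q _ (metrizes_nbhs _ dX e40)).
rewrite nbhsE => -[V [oV Vq] Vd].
(* A translate of [z] lands at [w] near [q]. The same element sends [p] to some [r], and [k], the
   value of [c] at [r], then puts [a k q] close to [a k w], hence to [a g0^-1 p] and to [x0]. *)
have [w [Vw [g _ wE]]] := dx0 V (ex_intro _ q Vq) oV.
have {wE}wE : w = a (g * g0^-1)%g z by rewrite act_mul -zE actK.
have pr : act_orbit a p (a (g * g0^-1)%g p) by exists (g * g0^-1)%g.
have := Vd _ Vw _ pr; have := svalP (c (a (g * g0^-1)%g p)) pr.
move: (sval _) => k kE; rewrite wE => qk.
have h1 := small g0^-1%g _ _ Uz Up; rewrite -zE actK in h1.
have := small (k * (g * g0^-1))%g _ _ Uz Up.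
rewrite !(act_mul a k) kE => h2.
have h3 : e <= d x0 (a k q) by apply: ex0; exists k.
have h4 := dD x0 (a g0^-1%g p) (a k q).
have h5 := dD (a g0^-1%g p) (a k (a (g * g0^-1)%g z)) (a k q).
rewrite (dC _ (a k (a _ z))) (dC (a k _) (a k q)) in h5.
by lra.
Qed.

(** The Heine-Cantor argument. Half of the radius [r] at [x] is kept for [y] and half for [z], so
    that both stay within [r] of [x]. *)
Lemma compact_uniform_continuity (T U : topologicalType) (d : T -> T -> R)
    (d' : U -> U -> R) (f : T -> U) (e : R) :
  compact [set: T] -> metrizes d -> metrizes d' -> continuous f -> 0 < e ->
  exists2 delta, 0 < delta &
    forall x y, d x y < delta -> d' (f x) (f y) < e.
Proof.
move=> cT dT dU cf e0.
have [[d0 dE dC dD] dn] := dT; have [[d0' dE' dC' dD'] dn'] := dU.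
have e20 : 0 < e / 2%:R by rewrite divr_gt0.
have : \forall delta \near (0:R)^'+, [set: T] `<=`
    (fun x => forall y, d x y < delta -> d' (f x) (f y) < e).
  move/compact_near_coveringP : cT; apply=> x _.
  have /dn[r r0 rP] := cf x _ (metrizes_nbhs (f x) dU e20).
  have r20 : 0 < r / 2%:R by rewrite divr_gt0.
  exists ([set y | d x y < r / 2%:R], [set t | t < r / 2%:R]).
    split; first exact: metrizes_nbhs.
    exact: nbhs_right_lt.
  move=> [y t] /= [xy tr] z yz.
  have /= h1 : d' (f x) (f y) < e / 2%:R by apply: rP => /=; lra.
  have /= h2 : d' (f x) (f z) < e / 2%:R.
    by apply: rP => /=; have := dD x y z; lra.
  by have := dD' (f y) (f x) (f z); rewrite (dC' (f y) (f x)); lra.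
move=> H; have [delta [/= del0 delP]] :=
  filter_ex (filterI (@nbhs_right_gt R 0) H).
by exists delta => // x y; exact: delP.
Qed.

(** One sensitive coordinate suffices: act there and trivially elsewhere. As the projection is
    uniformly continuous, points far apart in that coordinate are far apart in the product. *)
Lemma sensitive_prod (G : nat -> groupType) (X : nat -> topologicalType)
    (a : forall i, homeo_action (G i) (X i)) i (di : X i -> X i -> R)
    (d : prod_topology X -> prod_topology X -> R) :
  (forall j, compact [set: X j]) -> metrizes di -> metrizes d ->
  sensitive (a i) di -> sensitive (prod_act a) d.
Proof.
move=> cX dXi dX [e e0 eP].
have cP : compact [set: prod_topology X].
  have := tychonoff cX; congr compact.
  by apply/seteqP; split.
(* Half of [e], because the diameter is a supremum that need not be attained. *)
have e20 : 0 < e / 2%:R by rewrite divr_gt0.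
have [delta del0 delP] :=
  compact_uniform_continuity cP dX dXi (@proj_continuous _ X i) e20.
exists delta => // U oU [u Uu].
have [g gP] := eP (@proj nat X i @` U) (proj_open i oU) (ex_intro _ _ (imageP _ Uu)).
have [|_ [_ [[_ [x Ux <-] <-] [_ [y Uy <-] <-] xy]]] :=
    @lt_diam _ di (a i g @` (@proj nat X i @` U)) (e / 2%:R).
  by apply: lt_le_trans gP; rewrite lte_fin; lra.
pose h : prod_group G := dfwith (1%g : prod_group G) i g.
exists h; have hE z : prod_act a h z i = a i g (z i).
  by rewrite /= /prod_act_fun /h dfwithin.
apply: le_trans (@le_diam _ d _ (prod_act a h x) (prod_act a h y) _ _);
  [|by exists x|by exists y].
rewrite lee_fin leNgt; apply/negP => /delP.
by rewrite /proj !hE ltNge (ltW xy).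
Qed.

End Sensitivity.

(** * Fixed and non-fixed points of one factor *)

Section Factor.
Context (G : groupType) (X : topologicalType) (a : homeo_action G X).

Lemma fixed_orbit_closed x : hausdorff_space X -> fixed_point a x -> closed (act_orbit a x).
Proof.
move=> hX fx; have -> : act_orbit a x = [set x].
  by apply/seteqP; split=> [_ [g _ <-]|_ ->]; [exact: fx|exact: act_orbit_refl].
exact/accessible_closed_set1/hausdorff_accessible.
Qed.

Lemma not_fixed_orbit x : ~ fixed_point a x ->
  exists y z, [/\ act_orbit a x y, act_orbit a x z & y <> z].
Proof.
move=> /existsNP[g gx]; exists (a g x), x; split=> //.
  by exists g.
exact: act_orbit_refl.
Qed.

Lemma open_not_fixed : hausdorff_space X -> open [set x | ~ fixed_point a x].
Proof.
move=> hX.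
have -> : [set x | ~ fixed_point a x] = \bigcup_g [set x | a g x <> x].
  by apply/seteqP; split=> [x /existsNP[g gx]|x [g _ gx] /(_ g)//]; exists g.
by apply: bigcup_open => g _; exact: open_moved.
Qed.

(** Points of the dense non-closed orbit are not fixed, so the non-fixed points form a dense open
    set, which can be intersected with any [O] before looking for a closed orbit. *)
Lemma dense_closed_orbit_not_fixed : hausdorff_space X -> chaotic a ->
  dense [set x | closed (act_orbit a x) /\ ~ fixed_point a x].
Proof.
move=> hX [[x0 dx0 nclx0] dcl] O O0 oO.
have [y [Oy x0y]] := dx0 O O0 oO.
have Nfy : ~ fixed_point a y.
  by move=> /(fixed_orbit_closed hX); rewrite -(act_orbit_eq x0y).
have [z [[Oz Nfz] [w /= clw wz]]] :=
  dcl _ (ex_intro _ y (conj Oy Nfy)) (openI oO (open_not_fixed hX)).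
by exists z; split=> //; split=> //; rewrite -(act_orbit_eq wz).
Qed.

End Factor.

(** By induction on [n]: resetting coordinate [n] to [c n] gives a point of the smaller box, from
    which the original is recovered by its value at [n]. *)
Lemma finite_prod_box (X : nat -> Type) (A : forall i, set (X i)) n
    (c : forall i, X i) : (forall i, finite_set (A i)) ->
  finite_set [set x : forall i, X i |
    forall i, if (i < n)%N then A i (x i) else x i = c i].
Proof.
move=> fA; elim: n => [|n IH].
  apply: (@sub_finite_set _ _ [set c]); last exact: finite_set1.
  by move=> x xc; apply: functional_extensionality_dep => i; exact: xc i.
apply: (sub_finite_set _ (finite_image2 (fun x v => dfwith x n v) IH (fA n))).
move=> x xP; exists (dfwith x n (c n)).
  move=> i; have [->|ni] := eqVneq i n; first by rewrite ltnn dfwithin.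
  rewrite dfwithout 1?eq_sym//; have := xP i.
  by rewrite ltnS leq_eqVlt (negbTE ni).
exists (x n); first by have := xP n; rewrite ltnSn.
apply: functional_extensionality_dep => i.
have [->|ni] := eqVneq i n; first by rewrite dfwithin.
by rewrite !dfwithout// eq_sym.
Qed.

(** * From the factors to the product action *)

Theorem theorem1p7 (R : realType) (G : nat -> groupType)
    (X : nat -> topologicalType)
    (a : forall i : nat, homeo_action (G i) (X i))
    (G_homeo : forall i, homeo_group (a i))
    (G_countable : forall i, countable [set: G i])
    (X_compact : forall i, compact [set: X i])
    (X_metrizable : forall i, metrizable R (X i))
    (a_chaotic : forall i, chaotic (a i)) :
  chaotic (prod_act a) /\
  ((exists2 F : set (prod_topology X), dense F &
      exists2 D : set (prod_topology X),
        F = \bigcup_(x in D) act_orbit (prod_act a) x &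
        forall x, D x -> compact (act_orbit (prod_act a) x) /\
                         act_orbit (prod_act a) x #= [set: R]) /\
   (forall x : prod_topology X,
      compact (act_orbit (prod_act a) x) ->
      act_orbit (prod_act a) x #= [set: R] ->
      perfect_set (act_orbit (prod_act a) x))) /\
  (exists2 x : prod_topology X,
     dense (act_orbit (prod_act a) x) &
     act_orbit (prod_act a) x #= [set: R]) /\
  ((forall i, residually_finite (G i)) /\
   residually_finite (prod_group G)) /\
  ((forall i (d : X i -> X i -> R), metrizes d -> sensitive (a i) d) /\
   (forall d : prod_topology X -> prod_topology X -> R,
      metrizes d -> sensitive (prod_act a) d)) /\
  ((forall i, exists x : X i, fixed_point (a i) x) ->
   dense (\bigcup_(x in [set x | finite_set (act_orbit (prod_act a) x)])
            act_orbit (prod_act a) x) /\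
   exists x : prod_topology X, fixed_point (prod_act a) x).
Proof.
have hX i : hausdorff_space (X i) by exact: metrizable_hausdorff.
have hP : hausdorff_space (prod_topology X) by exact: hausdorff_product.
have cP : compact [set: prod_topology X].
  by have := tychonoff X_compact; congr compact; apply/seteqP; split.
have fin i x : closed (act_orbit (a i) x) -> finite_set (act_orbit (a i) x).
  exact: closed_orbit_finite.
have dfin i : dense (\bigcup_(x in [set x | finite_set (act_orbit (a i) x)])
    act_orbit (a i) x).
  move=> O O0 oO; have [y [Oy [x /= /fin fx xy]]] := (a_chaotic i).2 O O0 oO.
  by exists y; split=> //; exists x.
have x0 i : {x | dense (act_orbit (a i) x) & ~ closed (act_orbit (a i) x)}.
  by apply: cid2; have [] := a_chaotic i.
pose x : prod_topology X := fun i => s2val (x0 i).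
have xdense i : dense (act_orbit (a i) (x i)) := s2valP (x0 i).
have xNclosed i : ~ closed (act_orbit (a i) (x i)) := s2valP' (x0 i).
have Xdense : dense (act_orbit (prod_act a) x).
  by rewrite prod_act_orbitE; exact: (dense_prod xdense).
have card_orbit (y : prod_topology X) : (forall i, ~ fixed_point (a i) (y i)) ->
    act_orbit (prod_act a) y #= [set: R].
  move=> yNf; rewrite prod_act_orbitE.
  apply: (@card_prod_continuum R X (fun i => act_orbit (a i) (y i))) => i.
    exact: sub_countable (card_image_le _ _) (G_countable i).
  exact: not_fixed_orbit.
(* Every coordinate has a closed orbit with at least two points, which makes the product orbit
   compact and of cardinality continuum. *)
pose D := [set y : prod_topology X |
  forall i, closed (act_orbit (a i) (y i)) /\ ~ fixed_point (a i) (y i)].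
have dD : dense D.
  by exact: (dense_prod (fun i => dense_closed_orbit_not_fixed (hX i) (a_chaotic i))).
have D_closed y : D y -> closed (act_orbit (prod_act a) y).
  move=> Dy; rewrite prod_act_orbitE; apply: (@closed_prod X (fun i => act_orbit (a i) (y i))) => i.
  by have [] := Dy i.
have dense_orbits : dense (\bigcup_(y in D) act_orbit (prod_act a) y).
  move=> O O0 oO; have [y [Oy Dy]] := dD O O0 oO.
  by exists y; split=> //; exists y => //; exact: act_orbit_refl.
have rG i : residually_finite (G i).
  exact: (residually_finite_of_finite_orbits (G_homeo i) (hX i) (dfin i)).
have sG i (d : X i -> X i -> R) : metrizes d -> sensitive (a i) d.
  by move=> dX; exact: (sensitive_of_finite_orbits dX (xdense i) (xNclosed i)).
split.
  split; last first.
    move=> O O0 oO; have [y [Oy [z Dz zy]]] := dense_orbits O O0 oO.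
    by exists y; split=> //; exists z => //; exact: D_closed.
  (* A closed orbit of [x] would be compact, and so would its projection to coordinate 0, which is
     not closed. *)
  exists x => // clx; apply: (xNclosed 0%N).
  rewrite -proj_act_orbit; apply: compact_closed; first exact: hX.
  apply: continuous_compact; last exact: subclosed_compact clx cP _.
  by apply: continuous_subspaceT; exact: proj_continuous.
split.
  split.
    exists (\bigcup_(y in D) act_orbit (prod_act a) y) => //.
    exists D => // y Dy; split.
      exact: subclosed_compact (D_closed y Dy) cP _.
    by apply: card_orbit => i; have [] := Dy i.
  move=> y cy yR; have [fy|//] := compact_orbit_finite_or_perfect hP cy.
  (* A finite orbit cannot have the cardinality of [R], into which [nat] embeds. *)
  exfalso; move: fy; rewrite (eq_finite_set yR) finite_setPn; apply.
  apply: (@injective_card_le _ _ _ _ (fun n => n%:R%R : R)) => // m n _ _ /eqP.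
  by rewrite eqr_nat => /eqP.
split.
  exists x => //; apply: card_orbit => i /(fixed_orbit_closed (hX i)); exact: xNclosed.
split; first by split=> //; exact: residually_finite_prod.
split.
  split=> // d dX; have [d0 dX0] := X_metrizable 0%N.
  exact: sensitive_prod X_compact dX0 dX (sG 0%N d0 dX0).
move=> fixG.
have c i : {x : X i | fixed_point (a i) x} by exact: cid.
split; last first.
  exists (fun i => sval (c i)) => g.
  by apply: functional_extensionality_dep => i; exact: (svalP (c i)).
move=> O O0 oO.
(* Beyond [n] the point [y] has fixed coordinates, so its orbit lies in a box with finitely many
   finite sides. *)
have [n /(_ (fun i => sval (c i)))[y Oy yP]] := open_prod_meets dfin oO O0.
exists y; split=> //; exists y; last exact: act_orbit_refl.
have fy i : finite_set (act_orbit (a i) (y i)).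
  have := yP i; case: ifP => [_ [z /= fz zy]|_ ->].
    by rewrite -(act_orbit_eq zy).
  by apply: fin; apply: fixed_orbit_closed => //; exact: svalP.
rewrite /= prod_act_orbitE.
apply: (sub_finite_set _ (finite_prod_box n (fun i => sval (c i)) fy)) => z zy i.
have := zy i; have := yP i; case: ifP => // _ -> [g _ <-].
exact: (svalP (c i)).
Qed.
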